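(* Let $a\ge2$ be an even integer. The subtraction game $\mathcal{S}(1,a,2a)$ is periodic with period $3a$ and nim-sequence $(01)^{a/2}\,2\,(01)^{a/2}(23)^{(a-2)/2}\,2$. Moreover, the subtraction set has expansion $\big(\{1\}\cup\{a,a+2,\ldots,2a\}\cup\{3a-1\}\big)^{*(3a)}$.
   Context: For a finite set $S$ of positive integers, the subtraction game $\mathcal{S}(S)$ is played on a single pile: two players alternately remove $s\in S$ coins (at most the pile size); the last mover wins. The nim-value is $\mathcal{G}(n)=\operatorname{mex}\{\mathcal{G}(n-s): s\in S, s\le n\}$. Words of single digits are written by juxtaposition, and $x^m$ denotes $m$-fold repetition of the block $x$ ($x^0$ empty). ''The game is periodic with period $p$ and nim-sequence $W$'' ($W$ a word of length $p$) means $\mathcal{G}(n+p)=\mathcal{G}(n)$ for all $n\ge0$, $p$ is the least such, and $\mathcal{G}(n)$ is the $((n\bmod p)+1)$-st letter of $W$ for all $n\ge0$. The expansion of $S$ is $S^{ex}=\{s\ge1:\mathcal{G}(n+s)\ne\mathcal{G}(n)\ \forall n\ge0\}$; ''has expansion $T$'' means $S^{ex}=T$. For a set $X$ and $p\ge1$, $X^{*p}=\{x+mp:x\in X,m\ge0\}$.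
   Formalization: For a = 2 the claim that 3a is the least period is dropped, since the game S(1,2,4) has nim-values n mod 3 and least period 3; all other claims (3a is a period, the nim-sequence word, the expansion) are kept for a = 2. *)

(* Defs.v *)
From mathcomp Require Import all_boot.
From mathcomp Require Import classical_sets.

Set Implicit Arguments.
Unset Strict Implicit.
Unset Printing Implicit Defensive.

Local Open Scope classical_set_scope.

(* Among the size s + 1 naturals 0, ..., size s at least one is not in s, so
   the bounded search below always succeeds (mex_notin, mex_min). *)
Definition mex (s : seq nat) : nat :=
  find (fun i => i \notin s) (iota 0 (size s).+1).

Lemma mex_has (s : seq nat) : has (fun i => i \notin s) (iota 0 (size s).+1).
Proof.
rewrite has_predC; apply/negP => /allP sub.
have := uniq_leq_size (iota_uniq 0 (size s).+1) sub.
by rewrite size_iota ltnn.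
Qed.

Lemma mex_notin (s : seq nat) : mex s \notin s.
Proof.
have := nth_find 0 (mex_has s); rewrite nth_iota ?add0n //.
by have := mex_has s; rewrite has_find size_iota.
Qed.

Lemma mex_min (s : seq nat) (i : nat) : i < mex s -> i \in s.
Proof.
move=> lt_i; have := before_find 0 lt_i.
rewrite nth_iota ?add0n; first by move/negbFE.
by have := mex_has s; rewrite has_find size_iota; apply: ltn_trans.
Qed.

(* The finite subtraction set is given by a list S of positive integers;
   nim_values S n is the list of the nim-values of the piles 0, ..., n - 1. *)
Fixpoint nim_values (S : seq nat) (n : nat) : seq nat :=
  if n is m.+1 then
    let G := nim_values S m in
    rcons G (mex [seq nth 0 G (m - s) | s <- S & s <= m])
  else [::].

Definition nim_value (S : seq nat) (n : nat) : nat :=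
  last 0 (nim_values S n.+1).

Lemma size_nim_values (S : seq nat) (n : nat) : size (nim_values S n) = n.
Proof. by elim: n => //= n IHn; rewrite size_rcons IHn. Qed.

Lemma nth_nim_values (S : seq nat) (n i : nat) :
  i < n -> nth 0 (nim_values S n) i = nim_value S i.
Proof.
elim: n => // n IHn; rewrite ltnS leq_eqVlt => /predU1P[->|lt_in] /=.
  by rewrite /nim_value /= last_rcons nth_rcons size_nim_values ltnn eqxx.
by rewrite nth_rcons size_nim_values lt_in IHn.
Qed.

Lemma nim_valueE (S : seq nat) (n : nat) : all (leq 1) S ->
  nim_value S n = mex [seq nim_value S (n - s) | s <- S & s <= n].
Proof.
move=> /allP S_gt0; rewrite {1}/nim_value /= last_rcons; congr (mex _).
apply/eq_in_map => s; rewrite mem_filter => /andP[le_sn /S_gt0 s_gt0].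
apply: nth_nim_values; rewrite ltn_subrL s_gt0.
exact: leq_trans s_gt0 le_sn.
Qed.

Definition wpow (w : seq nat) (m : nat) : seq nat := flatten (nseq m w).

Definition is_period (g : nat -> nat) (p : nat) : Prop :=
  0 < p /\ forall n, g (n + p) = g n.

Definition is_least_period (g : nat -> nat) (p : nat) : Prop :=
  is_period g p /\ forall q, is_period g q -> p <= q.

Definition has_nim_sequence (g : nat -> nat) (p : nat) (W : seq nat) : Prop :=
  size W = p /\ forall n, g n = nth 0 W (n %% p).

Definition expansion (S : seq nat) : set nat :=
  [set s | 1 <= s /\ forall n, nim_value S (n + s) <> nim_value S n].

Definition star (X : set nat) (p : nat) : set nat :=
  [set x + m * p | x in X & m in [set: nat]].

(* Main.v *)
(** The word [W] is verified by strong induction on the pile size. Two letters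
    of [W] whose positions differ cyclically by [1] or by [a + 2 i]
    ([i <= a / 2]) are distinct; taking the distances [1], [a], [2 a] shows that
    no option of [n] has the nim-value of [n], while all smaller values occur
    among the options within the same block of length [3 a]. The remaining
    distances [d] fail: modulo the symmetry [d <-> 3 a - d], equal letters are
    found at positions [0] and [d], or at [a - 2] and [a - 2 + d]. *)
Require Import Defs.
From mathcomp Require Import all_boot.
From mathcomp Require Import classical_sets.
From mathcomp Require Import zify.

Set Implicit Arguments.
Unset Strict Implicit.
Unset Printing Implicit Defensive.

(** Contradictory branches are closed as soon as they appear, which keeps the nested case split
    small. *)
Ltac split_lia := repeat (case: ifP => ?; try lia); lia.

Lemma mex_eq (s : seq nat) (v : nat) :
  v \notin s -> (forall i, i < v -> i \in s) -> mex s = v.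
Proof.
move=> v_notin lt_v; case: (ltngtP (mex s) v) => // [/lt_v|/mex_min].
  by rewrite (negbTE (mex_notin s)).
by rewrite (negbTE v_notin).
Qed.

(** The two conditions say that [f n] is the mex of [f] over the options of [n], and this recursion
    has only one solution. *)
Lemma nim_value_unique (S : seq nat) (f : nat -> nat) : all (leq 1) S ->
    (forall n s, s \in S -> s <= n -> f (n - s) <> f n) ->
    (forall n i, i < f n -> exists2 s, s \in S & s <= n /\ f (n - s) = i) ->
  nim_value S =1 f.
Proof.
move=> S_gt0 f_neq f_lt; elim/ltn_ind => n IHn.
have IH s : s \in S -> s <= n -> nim_value S (n - s) = f (n - s).
  by move=> /(allP S_gt0) s_gt0 le_sn; apply: IHn; lia.
rewrite nim_valueE //; apply: mex_eq.
  apply/mapP => -[s]; rewrite mem_filter => /andP[le_sn sS].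
  by rewrite IH // => /esym; apply: f_neq.
move=> i /f_lt[s sS [le_sn <-]]; apply/mapP; exists s; last by rewrite IH.
by rewrite mem_filter le_sn.
Qed.

Lemma size_wpow (w : seq nat) (m : nat) : size (wpow w m) = m * size w.
Proof. by elim: m => //= m IHm; rewrite /wpow /= size_cat IHm. Qed.

Lemma nth_wpow2 (x y m i : nat) : i < 2 * m ->
  nth 0 (wpow [:: x; y] m) i = if odd i then y else x.
Proof.
elim: m i => [|m IHm] [|[|i]] //= lt_i.
rewrite -/(wpow _ m) IHm; last by lia.
by rewrite negbK.
Qed.

(* The last letter 2 of the word continues the alternation of 2 and 3. *)
Definition letter (a r : nat) : nat :=
  if r < a then r %% 2 else
  if r == a then 2 else
  if r <= 2 * a then (r - a - 1) %% 2 else 2 + (r - 2 * a - 1) %% 2.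

Lemma nth_word (b r : nat) : 0 < b -> r < 3 * (2 * b) ->
  nth 0 (wpow [:: 0; 1] b ++ [:: 2] ++ wpow [:: 0; 1] b
         ++ wpow [:: 2; 3] (b - 1) ++ [:: 2]) r = letter (2 * b) r.
Proof.
move=> b_gt0 lt_r; rewrite !nth_cat !size_wpow /= /letter.
case: ltnP => [?|?]; first by rewrite nth_wpow2; split_lia.
case: ltnP => [?|?].
  by rewrite (_ : r - _ = 0) /=; split_lia.
case: ltnP => [?|?]; first by rewrite nth_wpow2; split_lia.
case: ltnP => [?|?]; first by rewrite nth_wpow2; split_lia.
by rewrite (_ : r - _ - _ - _ - _ = 0) /=; split_lia.
Qed.

Definition periodic_letter (a n : nat) : nat := letter a (n %% (3 * a)).

Lemma periodic_letterE (a n : nat) : n < 3 * a ->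
  periodic_letter a n = letter a n.
Proof. by move=> lt_n; rewrite /periodic_letter modn_small. Qed.

Lemma periodic_letterDM (a n m : nat) :
  periodic_letter a (n + m * (3 * a)) = periodic_letter a n.
Proof. by rewrite /periodic_letter addnC modnMDl. Qed.

Lemma periodic_letterD (a n : nat) :
  periodic_letter a (n + 3 * a) = periodic_letter a n.
Proof. by rewrite -{1}[3 * a]mul1n periodic_letterDM. Qed.

(** Working with the residue [r] and at most one wrap-around turns claims about distances into case
    splits in linear arithmetic. *)
Lemma periodic_letter_addr (a n d : nat) : 0 < a -> d < 3 * a ->
  exists2 r, r < 3 * a &
    periodic_letter a n = letter a r /\
    periodic_letter a (n + d) =
      letter a (if r + d < 3 * a then r + d else r + d - 3 * a).
Proof.
move=> a_gt0 lt_d; have lt_r : n %% (3 * a) < 3 * a by rewrite ltn_mod; lia.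
exists (n %% (3 * a)) => //; split=> //.
rewrite /periodic_letter -modnDml; congr (letter a _); case: ltnP => [lt|le].
  by rewrite modn_small.
by rewrite -{1}(subnK le) modnDr modn_small //; lia.
Qed.

Lemma periodic_letter_add1 (b n : nat) : 0 < b ->
  periodic_letter (2 * b) (n + 1) <> periodic_letter (2 * b) n.
Proof.
move=> b_gt0.
have [||r lt_r [-> ->]] := @periodic_letter_addr (2 * b) n 1; try lia.
by case: ifP => ?; rewrite /letter; split_lia.
Qed.

(** The letter 2 at position [2 * b] moves the second run of 0 and 1 by one place, so even distances
    between the two runs join unequal letters. *)
Lemma periodic_letter_add_even (b n i : nat) : 0 < b -> i <= b ->
  periodic_letter (2 * b) (n + (2 * b + 2 * i)) <> periodic_letter (2 * b) n.
Proof.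
move=> b_gt0 le_ib.
have [||r lt_r [-> ->]] := @periodic_letter_addr (2 * b) n (2 * b + 2 * i);
  try lia.
by case: ifP => ?; rewrite /letter; split_lia.
Qed.

Lemma periodic_letter_addB1 (b n : nat) : 0 < b ->
  periodic_letter (2 * b) (n + (3 * (2 * b) - 1)) <> periodic_letter (2 * b) n.
Proof.
move=> b_gt0 eq_n.
(* Modulo the period the distance is -1, so one more step leads back to [n]. *)
apply: (@periodic_letter_add1 b (n + (3 * (2 * b) - 1))) => //.
by rewrite -addnA subnK ?periodic_letterD //; lia.
Qed.

Lemma periodic_letter_option (b n i : nat) : 0 < b ->
  i < periodic_letter (2 * b) n ->
  exists2 s, s \in [:: 1; 2 * b; 2 * (2 * b)] &
    s <= n /\ periodic_letter (2 * b) (n - s) = i.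
Proof.
move=> b_gt0; have lt_r : n %% (3 * (2 * b)) < 3 * (2 * b).
  by rewrite ltn_mod; lia.
have shift s : s <= n %% (3 * (2 * b)) ->
    periodic_letter (2 * b) (n - s) = letter (2 * b) (n %% (3 * (2 * b)) - s).
  move=> le_s; rewrite {1}(divn_eq n (3 * (2 * b))) -addnBA // addnC.
  by rewrite periodic_letterDM periodic_letterE //; lia.
have := leq_mod n (3 * (2 * b)).
rewrite {1}/periodic_letter.
move: (n %% _) lt_r shift => r lt_r shift le_rn lt_i.
suff [s sS [le_sr eq_i]] : exists2 s, s \in [:: 1; 2 * b; 2 * (2 * b)] &
    s <= r /\ letter (2 * b) (r - s) = i.
  by exists s => //; split; [lia | rewrite shift].
pose good s := (s <= r) && (letter (2 * b) (r - s) == i).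
(* Below a 1 or a 3, removing 1 gives 0 or 2 respectively. At [r = 2 * b], removing 1 and [2 * b]
   gives 1 and 0. In the last third, removing [2 * b] and [2 * (2 * b)] gives 0 and 1 in some
   order. *)
suff /or3P[] : [|| good 1, good (2 * b) | good (2 * (2 * b))].
- by case/andP=> ? /eqP ?; exists 1.
- by case/andP=> ? /eqP ?; exists (2 * b); rewrite ?inE ?eqxx ?orbT.
- by case/andP=> ? /eqP ?; exists (2 * (2 * b)); rewrite ?inE ?eqxx ?orbT.
by move: lt_i; rewrite /good /letter; split_lia.
Qed.

Lemma nim_value_periodic_letter (b : nat) : 0 < b ->
  nim_value [:: 1; 2 * b; 2 * (2 * b)] =1 periodic_letter (2 * b).
Proof.
move=> b_gt0; apply: nim_value_unique => [|n s|n i]; first by rewrite /=; lia.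
  (* The moves [2 * b] and [2 * (2 * b)] are the even distances with [i = 0] and [i = b]. *)
  rewrite !inE => /or3P[] /eqP -> le_sn /esym; rewrite -{1}(subnK le_sn).
  - exact: periodic_letter_add1.
  - by have := @periodic_letter_add_even b (n - 2 * b) 0 b_gt0 (leq0n b);
      rewrite muln0 addn0.
  - by have := @periodic_letter_add_even b (n - 2 * (2 * b)) b b_gt0 (leqnn b);
      rewrite addnn -mul2n.
exact: periodic_letter_option.
Qed.

Lemma periodic_letter_least_period (b : nat) : 1 < b ->
  is_least_period (periodic_letter (2 * b)) (3 * (2 * b)).
Proof.
move=> b_gt1; split; first by split; [lia | exact: periodic_letterD].
move=> q [q_gt0 per_q]; case: leqP => // lt_q.
have per n : n < 3 * (2 * b) -> n + q < 3 * (2 * b) ->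
    letter (2 * b) (n + q) = letter (2 * b) n.
  by move=> ? ?; rewrite -!periodic_letterE.
(* Position [0] forces letter 0 at [q]; [2 * b] then excludes [q < 2 * b], and [2 * b + 1] leaves
   only [q = 2 * (2 * b) - 1]. There [2 * b - 1] would have to carry the letter 3, which occurs at
   [2 * b - 1 + q] because [1 < b]. *)
have := per 0; have := per (2 * b); have := per (2 * b - 1).
have := per (2 * b + 1); rewrite /letter; split_lia.
Qed.

Lemma periodic_letter_repeat (b d : nat) : 0 < b -> d < 3 * (2 * b) ->
    d != 1 -> d != 3 * (2 * b) - 1 ->
    (forall i, i <= b -> d != 2 * b + 2 * i) ->
  exists n, periodic_letter (2 * b) (n + d) = periodic_letter (2 * b) n.
Proof.
move=> b_gt0 lt_d d_neq1 d_neqB1 d_notin.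
have repeat_small e : e <= 2 * (2 * b) -> e != 1 ->
    (forall i, i <= b -> e != 2 * b + 2 * i) ->
    exists n, periodic_letter (2 * b) (n + e) = periodic_letter (2 * b) n.
  move=> le_e e_neq1 e_notin.
  have e_neq := e_notin ((e - 2 * b) %/ 2).
  have [/andP[odd_e lt_e]|e_even] := boolP (odd e && (e < 2 * b)).
    (* As [e] is odd and at least 3, the shifted position lies in the second run of 0 and 1, where
       odd positions carry 0. *)
    by exists (2 * b - 2); rewrite !periodic_letterE /letter; split_lia.
  (* Now [e] is even and below [2 * b], or odd and above it; in both cases the letter at [e] is
     0. *)
  by exists 0; rewrite !periodic_letterE /letter; split_lia.
have [le_d|gt_d] := leqP d (2 * (2 * b)); first exact: repeat_small.
(* The complement is below [2 * b], and it differs from 1 by [d_neqB1]. *)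
have [|||n eq_n] := repeat_small (3 * (2 * b) - d); try lia.
exists (n + (3 * (2 * b) - d)).
by rewrite -addnA subnK ?periodic_letterD //; lia.
Qed.

Lemma expansion_periodic_letter (b : nat) : 0 < b ->
  expansion [:: 1; 2 * b; 2 * (2 * b)] =
    star ([set 1] `|` [set 2 * b + 2 * i | i in [set i | i <= b]]
          `|` [set 3 * (2 * b) - 1])%classic (3 * (2 * b)).
Proof.
move=> b_gt0; apply/seteqP; split=> [s [s_gt0 s_exp]|s [x xX [m _ <-]]].
  have lt_r : s %% (3 * (2 * b)) < 3 * (2 * b) by rewrite ltn_mod; lia.
  exists (s %% (3 * (2 * b))); last first.
    by exists (s %/ (3 * (2 * b))) => //; rewrite addnC -divn_eq.
  have r_exp n : periodic_letter (2 * b) (n + s %% (3 * (2 * b))) <>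
                 periodic_letter (2 * b) n.
    rewrite -(@periodic_letterDM _ _ (s %/ (3 * (2 * b)))) -addnA.
    rewrite [s %% _ + _]addnC -divn_eq -!nim_value_periodic_letter //.
  move: (s %% _) lt_r r_exp => r lt_r r_exp.
  have [->|r_neq1] := eqVneq r 1; first by left; left.
  have [->|r_neqB1] := eqVneq r (3 * (2 * b) - 1); first by right.
  (* The quotient is the only possible index [i]; for [r < 2 * b] truncation makes it 0 and the
     equality fails. *)
  have [/andP[le_r /eqP def_r]|r_notin] := boolP
      (((r - 2 * b) %/ 2 <= b) && (r == 2 * b + 2 * ((r - 2 * b) %/ 2))).
    by left; right; exists ((r - 2 * b) %/ 2).
  have [//||n /r_exp//] := @periodic_letter_repeat b r b_gt0 lt_r r_neq1.
  by move=> i le_i; lia.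
split.
  by case: xX => [[->|[i _ <-]]|->]; lia.
move=> n; rewrite !nim_value_periodic_letter // addnA periodic_letterDM.
case: xX => [[->|[i le_ib <-]]|->].
- exact: periodic_letter_add1.
- exact: periodic_letter_add_even.
- exact: periodic_letter_addB1.
Qed.

Theorem theorem3p7 (a : nat) (a_ge2 : 2 <= a) (a_even : ~~ odd a) :
  let S := [:: 1; a; 2 * a] in
  let W := wpow [:: 0; 1] (a %/ 2) ++ [:: 2] ++ wpow [:: 0; 1] (a %/ 2)
           ++ wpow [:: 2; 3] ((a - 2) %/ 2) ++ [:: 2] in
  [/\ is_period (nim_value S) (3 * a),
      (* for a = 2 the word W is 012012 and the least period is 3 *)
      a <> 2 -> is_least_period (nim_value S) (3 * a),
      has_nim_sequence (nim_value S) (3 * a) W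
    & expansion S =
      star ([set 1] `|` [set a + 2 * i | i in [set i | i <= a %/ 2]]
            `|` [set 3 * a - 1])%classic (3 * a)].
Proof.
(* Writing [a] as [2 * b] brings its parity within reach of [lia]. *)
have [b def_a] : exists b, a = 2 * b by exists (a %/ 2); lia.
subst a; have b_gt0 : 0 < b by lia.
rewrite (_ : (2 * b) %/ 2 = b); last by lia.
rewrite (_ : (2 * b - 2) %/ 2 = b - 1); last by lia.
move=> S W; have G_letter := nim_value_periodic_letter b_gt0.
have G_period : is_period (nim_value S) (3 * (2 * b)).
  by split=> [|n]; [lia | rewrite !G_letter periodic_letterD].
split=> //.
- move=> b_neq1; split=> // q [q_gt0 per_q].
  have [|_] := @periodic_letter_least_period b; first by lia.
  by apply; split=> // n; rewrite -!G_letter.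
- split; first by rewrite !size_cat !size_wpow /=; lia.
  by move=> n; rewrite G_letter nth_word // ltn_mod; lia.
exact: expansion_periodic_letter.
Qed.
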